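(* Let $P(\partial_t,\partial_z)=\sum_{(j,r)\in\Lambda}a_{jr}(t,z)\partial_t^j\partial_z^r$ be a partial differential operator with $\Lambda\subset\mathbb{N}_0\times\mathbb{N}_0$ finite and coefficients $a_{jr}(t,z)\in\mathcal{O}[[t]]$ (or, more generally, $a_{jr}(t,z)\in\mathbb{C}[[t,z]]$), and assume that $m:=\max_{(j,r)\in\Lambda}(j-\mathrm{ord}_t(a_{jr}))\ge 0$. Let $l$, $\tilde P_m(n,\partial_z)$ and $W_{m,l}(n,k,z)$ be associated with $P(\partial_t,\partial_z)$ as in the context. Then any two of the following three conditions entail the third one: (i) The operator $P(\partial_t,\partial_z)\partial_t^{-m}$ is a linear automorphism on $\mathbb{C}[[t,z]]$. (ii) The lower ordinate of the Newton polygon $N(\tilde P_m(n,\partial_z))$ is equal to $l$ for every $n\in\mathbb{N}_0$, and $l=0$. (iii) The non-resonance condition $W_{m,l}(n,k,0)\neq 0$ holds for every $n,k\in\mathbb{N}_0$.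
   Context: $\mathbb{N}_0=\{0,1,2,\dots\}$. $\mathcal{O}[[t]]$ is the set of formal power series in $t$ whose coefficients are holomorphic functions of $z$ on some common neighborhood of the origin. The coefficients $a_{jr}$, $(j,r)\in\Lambda$, are nonzero ($\Lambda$ nonempty), and are written $a_{jr}(t,z)=\sum_{n\ge \mathrm{ord}_t(a_{jr})}a_{j,r,n}(z)t^n$, where $\mathrm{ord}_t(a_{jr})$ is the order of the zero of $a_{jr}$ in $t$ at $t=0$. The operator $\partial_t^{-1}$ is $\partial_t^{-1}u(t)=\int_0^t u(\tau)\,d\tau$ (termwise on formal power series), and $\partial_t^{-m}$ is its $m$-th iterate. Put $\Lambda_m:=\{(j,r)\in\Lambda: j-\mathrm{ord}_t(a_{jr})=m\}$ (so $j\ge m$ for $(j,r)\in\Lambda_m$). For $(j,r)\in\Lambda_m$ write $a_{j,r,j-m}(z)=z^{\alpha_{j,r}}\tilde a_{j,r,j-m}(z)$ with $\alpha_{j,r}=\mathrm{ord}_z(a_{j,r,j-m}(z))$ (so $\tilde a_{j,r,j-m}(0)\ne0$). For $n\in\mathbb{N}_0$ define $$\tilde P_m(n,\partial_z)=\sum_{(j,r)\in\Lambda_m}\tilde a_{j,r,j-m}(z)z^{\alpha_{j,r}}\,n(n-1)\cdots(n-(j-m)+1)\,\partial_z^r ,$$ $$l:=\min_{(j,r)\in\Lambda_m}(\alpha_{j,r}-r),\qquad \Lambda_{m,l}:=\{(j,r)\in\Lambda_m:\alpha_{j,r}-r=l\},$$ $$W_{m,l}(n,k,z)=\sum_{(j,r)\in\Lambda_{m,l}}\tilde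 a_{j,r,j-m}(z)\,n(n-1)\cdots(n-(j-m)+1)\,k(k-1)\cdots(k-r+1),$$ where empty products equal $1$. For a one-variable operator $R(\partial_z)=\sum_{j\in\Gamma}b_j(z)\partial_z^j$ (terms with the same power of $\partial_z$ collected, $\Gamma\subset\mathbb{N}_0$ finite, all $b_j\neq0$), its Newton polygon is $N(R)=\mathrm{conv}\{\bigcup_{j\in\Gamma}Q(j,\mathrm{ord}_z(b_j)-j)\}$, where $Q(a,b)=\{(x,y)\in\mathbb{R}^2:x\le a,\ y\ge b\}$, and its lower ordinate is $\min_{j\in\Gamma}(\mathrm{ord}_z(b_j)-j)$. (For the zero operator there is no lower ordinate, so it is not equal to any integer.) *)

(* Defs.v *)
From mathcomp Require Import all_boot all_order all_algebra finmap zify.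
From mathcomp Require Import boolp classical_sets functions reals.
From mathcomp Require Export complex.

Set Implicit Arguments.
Unset Strict Implicit.
Unset Printing Implicit Defensive.

Import Order.TTheory GRing.Theory Num.Theory.
Local Open Scope ring_scope.
Local Open Scope classical_set_scope.

Definition is_minimum (A : set int) (x : int) : Prop := A x /\ lbound A x.
Definition is_maximum (A : set int) (x : int) : Prop := A x /\ ubound A x.

Section FormalPowerSeries.
Variable K : fieldType.

(* Formal power series are coefficient families: [f k] is the coefficient of
   z^k, and [u n k] that of t^n z^k, so that K[[t,z]] = K[[z]][[t]] and [u n] is
   the coefficient of t^n. The pointwise vector space structure of function
   types over K^o is the one of power series; the pointwise product is not
   used, see [fps2_mul]. *)
Definition fps1 := nat -> K^o.
Definition fps2 := nat -> fps1.

Definition fps2_mul (u v : fps2) : fps2 := fun n k =>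
  \sum_(i < n.+1) \sum_(j < k.+1) (u i j : K) * (v (n - i)%N (k - j)%N : K).

Definition dt (u : fps2) : fps2 := fun n k => n.+1%:R * (u n.+1 k : K).

Definition dz (u : fps2) : fps2 := fun n k => k.+1%:R * (u n k.+1 : K).

(* termwise integration from 0 in t *)
Definition dt_inv (u : fps2) : fps2 := fun n k =>
  if n is n'.+1 then n'.+1%:R^-1 * (u n' k : K) else 0.

Definition linear_automorphism (f : fps2 -> fps2) : Prop :=
  linear f /\ bijective f.

End FormalPowerSeries.

(* Order of vanishing of a series with coefficients in V: [ord a] is ord_t for
   a : fps2 K and [ord b] is ord_z for b : fps1 K. The value at the zero series
   is the junk value 0. *)
Definition ord (V : zmodType) (f : nat -> V) : nat :=
  if pselect (exists n, f n != 0) is left h then ex_minn h else 0%N.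

Lemma ord_neq0 (V : zmodType) (f : nat -> V) : f != 0 -> f (ord f) != 0.
Proof.
move=> f0; rewrite /ord; case: pselect => [h|h]; first by case: ex_minnP.
case/eqP: f0; apply/funext => n; rewrite [RHS](_ : _ = 0) //.
apply: contrapT => /eqP fn; by apply: h; exists n.
Qed.

Lemma ord_min (V : zmodType) (f : nat -> V) n : (n < ord f)%N -> f n = 0.
Proof.
rewrite /ord; case: pselect => [h|//]; case: ex_minnP => m _ mmin nm.
by apply/eqP; apply: contraTT nm => fn; rewrite -leqNgt mmin.
Qed.

Section NewtonPolygon.
Variable K : fieldType.

(* A one-variable operator R(d_z) = \sum_j b_j(z) d_z^j is given by its
   coefficients b (finitely many nonzero), the terms with the same power of d_z
   being collected; Gamma is then {j | b j != 0}. *)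
Definition is_lower_ordinate (b : nat -> fps1 K) (y : int) : Prop :=
  is_minimum [set (ord (b j))%:Z - j%:Z | j in [set j | b j != 0]] y.

Definition newton_quadrant (R : realType) (x y : R) : set (R * R) :=
  [set p | p.1 <= x /\ y <= p.2].

Definition convex_hull (R : realType) (A : set (R * R)) : set (R * R) :=
  [set p | forall C : set (R * R),
    (forall q r (s : R), C q -> C r -> 0 <= s <= 1 ->
       C (s * q.1 + (1 - s) * r.1, s * q.2 + (1 - s) * r.2)) ->
    A `<=` C -> C p].

Definition newton_polygon (R : realType) (b : nat -> fps1 K) : set (R * R) :=
  convex_hull (\bigcup_(j in [set j | b j != 0])
    newton_quadrant j%:R ((ord (b j))%:R - j%:R)).

Lemma lower_ordinate_newton_polygon (R : realType) (b : nat -> fps1 K)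
    (y : int) : is_lower_ordinate b y ->
  (exists2 p : R * R, newton_polygon b p & p.2 = y%:~R) /\
  (forall p : R * R, newton_polygon b p -> y%:~R <= p.2).
Proof.
have ordE j : ((ord (b j))%:Z - j%:Z)%:~R = (ord (b j))%:R - j%:R :> R.
  by rewrite intrB !pmulrn.
move=> [[j bj yE] ymin]; split.
  exists (j%:R, y%:~R) => // C _; apply; exists j => //.
  by split => //=; rewrite -yE ordE.
move=> p /(_ [set q | y%:~R <= q.2]); apply=> [q r s /= yq yr /andP[s0 s1]|].
  rewrite [leLHS](_ : _ = s * y%:~R + (1 - s) * y%:~R); last first.
    by rewrite -mulrDl subrKC mul1r.
  by apply: lerD; apply: ler_wpM2l; rewrite // subr_ge0.
move=> q [i bi [_ /=]]; apply: le_trans.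
by rewrite -ordE ler_int; apply: ymin; exists i.
Qed.

End NewtonPolygon.

Section Operator.
Variable K : fieldType.
(* The operator is \sum_((j, r) in L) a j r * d_t^j d_z^r. *)
Variables (L : {fset nat * nat}) (a : nat -> nat -> fps2 K).

Definition pdo (u : fps2 K) : fps2 K :=
  \sum_(p <- L) fps2_mul (a p.1 p.2) (iter p.1 (@dt K) (iter p.2 (@dz K) u)).

Definition t_weight (p : nat * nat) : int := p.1%:Z - (ord (a p.1 p.2))%:Z.

(* m is the maximum of the t_weight over L *)
Variable m : nat.

Definition Lambda_m : {fset nat * nat} :=
  [fset p in L | t_weight p == m%:Z]%fset.

(* a_{j,r,j-m}(z), where m <= j for (j, r) in Lambda_m *)
Definition lead_t (p : nat * nat) : fps1 K := a p.1 p.2 (p.1 - m)%N.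

Definition alpha (p : nat * nat) : nat := ord (lead_t p).

(* the factor with lead_t p = z^(alpha p) * lead_tz p, see [lead_tE] *)
Definition lead_tz (p : nat * nat) : fps1 K := fun k => lead_t p (alpha p + k)%N.

Lemma lead_tE p k : lead_t p k =
  if (k < alpha p)%N then 0 else lead_tz p (k - alpha p)%N.
Proof. by case: ltnP => [/ord_min//|h]; rewrite /lead_tz subnKC. Qed.

Lemma lead_tz0 p : a p.1 p.2 != 0 -> t_weight p = m%:Z ->
  lead_tz p 0%N != 0.
Proof.
move=> /ord_neq0 a0 wp; rewrite /lead_tz addn0; apply: ord_neq0.
rewrite /lead_t; suff -> : (p.1 - m = ord (a p.1 p.2))%N by [].
by apply/eqP; rewrite -eqz_nat; move: wp; rewrite /t_weight; lia.
Qed.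

(* Coefficient of d_z^r in P~_m(n, d_z). *)
Definition Pm (n : nat) (r : nat) : fps1 K :=
  \sum_(p <- Lambda_m | p.2 == r) (n ^_ (p.1 - m))%:R *: lead_t p.

Definition z_weight (p : nat * nat) : int := (alpha p)%:Z - p.2%:Z.

Variable l : int.

Definition Lambda_ml : {fset nat * nat} :=
  [fset p in Lambda_m | z_weight p == l]%fset.

Definition W (n k : nat) : fps1 K :=
  \sum_(p <- Lambda_ml) ((n ^_ (p.1 - m))%:R * (k ^_ p.2)%:R) *: lead_tz p.

End Operator.

(* Main.v *)
(* In the t-degree the operator P d_t^{-m} is block triangular with diagonal
   blocks P~_m(n, d_z) acting on K[[z]]. If l = 0, these blocks are themselves
   triangular in the z-degree with diagonal entries W_{m,l}(n, k, 0), so that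
   bijectivity amounts to the non-vanishing of all these entries. Independently
   of that, l > 0 makes every element of the image vanish at the origin, l < 0
   makes every term of W_{m,l}(n, 0, 0) vanish, and W_{m,l}(n, k, 0) is a
   combination of the coefficients of z^(l+r) in the factor of d_z^r in
   P~_m(n, d_z): if it is nonzero, the lower ordinate l is attained. *)
Require Import Defs.
From mathcomp Require Import all_boot all_order all_algebra finmap zify ring.
From mathcomp Require Import boolp classical_sets functions reals.

Set Implicit Arguments.
Unset Strict Implicit.
Unset Printing Implicit Defensive.

Import Order.TTheory GRing.Theory Num.Theory.
Local Open Scope ring_scope.
Local Open Scope classical_set_scope.

(** * Additive triangular maps on sequences *)

Section TriangularMaps.
Variables (V : zmodType) (F : (nat -> V) -> (nat -> V)) (D : nat -> V -> V).
Hypothesis FB : GRing.zmod_morphism F.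
(** With additivity this encodes triangularity: [F u n] depends only on [u 0], ..., [u n], and [D n]
    is the diagonal block. *)
Hypothesis FD : forall u n, (forall i, (i < n)%N -> u i = 0) ->
  F u n = D n (u n).

Let F0 : F 0 = 0.
Proof. by have := FB 0 0; rewrite !subrr. Qed.

Let D0 n : D n 0 = 0.
Proof. by rewrite -(FD (u := 0)) // F0. Qed.

Lemma triangular_inj : (forall n, injective (D n)) -> injective F.
Proof.
move=> Dinj u v Fuv; apply/eqP; rewrite -subr_eq0; apply/eqP.
set w := u - v; have Fw : F w = 0 by rewrite FB Fuv subrr.
apply/funext => n; rewrite [RHS](_ : _ = 0) //.
elim/ltn_ind: n => n IH; apply: (Dinj n); rewrite D0.
by rewrite -FD // Fw.
Qed.

(** Forward substitution: each coefficient of the preimage is found from the earlier ones by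
    inverting one diagonal block on the residual. *)
Lemma triangular_surj : (forall n, exists E, cancel E (D n)) ->
  exists G, cancel G F.
Proof.
move=> /choice[E DK].
(* [U v n] is the preimage truncated to degrees below [n]; [step] fills in coefficient [n], and
   coefficient [i] is frozen from stage [i.+1] on. *)
pose step v (u : nat -> V) n : nat -> V :=
  fun i => if i == n then u n + E n (v n - F u n) else u i.
pose U v := fix U n := if n is n'.+1 then step v (U n') n' else (0 : nat -> V).
have US v n i : (i < n)%N -> U v n i = U v i.+1 i.
  elim: n => // n IH; rewrite ltnS leq_eqVlt => /orP[/eqP->//|lin].
  by rewrite [LHS]/= {1}/step ltn_eqF // IH.
have U_ge v n i : (n <= i)%N -> U v n i = 0.
  elim: n => // n IH lni /=.
  by rewrite /step gtn_eqF // IH // ltnW.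
exists (fun v i => U v i.+1 i) => v; set u := fun i => _.
apply/funext => n.
(* The difference vanishes below [n], and [U v n] has coefficient 0 at [n] itself. *)
have : F (u - U v n) n = D n (u n).
  rewrite FD => [|i lin]; last first.
    by apply/eqP; rewrite subr_eq0 /u US.
  congr (D n _); rewrite -[RHS]subr0; congr (_ - _); exact: U_ge.
rewrite FB /u /= {2}/step eqxx U_ge // add0r DK => /eqP.
by rewrite subr_eq => /eqP ->; rewrite [X in _ + X]/= subrK.
Qed.

Lemma triangular_bij : (forall n, bijective (D n)) -> bijective F.
Proof.
move=> Dbij.
have Finj : injective F by apply: triangular_inj => n; exact: bij_inj.
have [n|G FG] := triangular_surj; first by have [E _ DE] := Dbij n; exists E.
by exists G => // u; apply: Finj; rewrite FG.
Qed.

(* Surjectivity of F alone does not pass to the diagonal blocks: the injectivity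
   of the lower blocks is what forces a preimage of a sequence supported in
   degree n to vanish below n. *)
Lemma triangular_diag_surj :
    (forall v, exists u, F u = v) ->
    (forall n, (forall y, exists x, D n x = y) -> injective (D n)) ->
  forall n y, exists x, D n x = y.
Proof.
move=> Fsurj Dinj n; elim/ltn_ind: n => n IH y.
have [u Fu] := Fsurj (fun i => if i == n then y else 0).
exists (u n); rewrite -FD ?Fu ?eqxx // => i.
elim/ltn_ind: i => i IHi lin; apply: (Dinj i (IH i lin)).
rewrite D0 -FD ?Fu ?ltn_eqF // => k lki.
by apply: IHi => //; apply: ltn_trans lin.
Qed.

End TriangularMaps.

Lemma ffactnD n p q : (n ^_ (p + q) = n ^_ p * (n - p) ^_ q)%N.
Proof.
elim: p n => [|p IH] n; first by rewrite subn0 mul1n.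
by case: n => [|n]; rewrite ?ffact0n ?addSn // !ffactSS IH mulnA.
Qed.

(** * Coefficients of the composed operator *)

Section LeadingPart.
Variables (K : numFieldType) (L : {fset nat * nat}) (a : nat -> nat -> fps2 K).
Variable m : nat.
Implicit Types (u : fps2 K) (w : fps1 K).

Lemma iter_dtE j u n k :
  iter j (@dt K) u n k = ((n + j) ^_ j)%:R * (u (n + j)%N k : K).
Proof.
elim: j n => [|j IH] n; first by rewrite addn0 mul1r.
by rewrite iterS /dt IH mulrA -natrM addSnnS ffactnSr mulnC -addSnnS addnK.
Qed.

Lemma iter_dzE r u n k :
  iter r (@dz K) u n k = ((k + r) ^_ r)%:R * (u n (k + r)%N : K).
Proof.
elim: r k => [|r IH] k; first by rewrite addn0 mul1r.
by rewrite iterS /dz IH mulrA -natrM addSnnS ffactnSr mulnC -addSnnS addnK.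
Qed.

Lemma iter_dt_invE u n k : iter m (@dt_inv K) u n k =
  if (m <= n)%N then (n ^_ m)%:R^-1 * (u (n - m)%N k : K) else 0.
Proof.
elim: m n => [|q IH] n; first by rewrite subn0 invr1 mul1r.
case: n => [|n] //; rewrite iterS /= IH ltnS subSS ffactSS.
by case: ifP => _; rewrite ?mulr0 // natrM invfM mulrA.
Qed.

Definition pdo_shift u : fps2 K := pdo L a (iter m (@dt_inv K) u).

Lemma pdo_shiftE u n k : pdo_shift u n k =
  \sum_(p <- L) \sum_(i < n.+1) \sum_(j < k.+1) (a p.1 p.2 i j : K) *
    (((n - i + p.1) ^_ p.1)%:R * (((k - j + p.2) ^_ p.2)%:R *
      (if (m <= n - i + p.1)%N then ((n - i + p.1) ^_ m)%:R^-1 *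
         (u (n - i + p.1 - m)%N (k - j + p.2)%N : K) else 0))).
Proof.
rewrite /pdo_shift /pdo fct_sumE fct_sumE; apply: eq_bigr => p _.
apply: eq_bigr => i _; apply: eq_bigr => j _.
by rewrite iter_dtE iter_dzE iter_dt_invE.
Qed.

Lemma pdo_shift_linear : linear pdo_shift.
Proof.
move=> c u v; apply/funext => n; apply/funext => k.
rewrite !fctE !pdo_shiftE [c *: _]mulr_sumr -big_split; apply: eq_bigr => p _.
rewrite mulr_sumr -big_split; apply: eq_bigr => i _.
rewrite mulr_sumr -big_split; apply: eq_bigr => j _ /=.
case: ifP => _; last by rewrite !mulr0 addr0.
have E (A x y z e f : K) : A * (x * (y * (z * (c * e + f)))) =
  c * (A * (x * (y * (z * e)))) + A * (x * (y * (z * f))) by ring.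
exact: E.
Qed.

Lemma fps1_scaleE (c : K) w k : (c *: w) k = c * (w k : K).
Proof. by []. Qed.

(* The action of P~_m(n, d_z) on K[[z]]. *)
Definition lead_op n w : fps1 K := fun k =>
  \sum_(p <- Lambda_m L a m) (n ^_ (p.1 - m))%:R *
    \sum_(i < k.+1) (lead_t a m p i : K) *
      (((k - i + p.2) ^_ p.2)%:R * (w (k - i + p.2)%N : K)).

Lemma lead_op_zmod_morphism n : GRing.zmod_morphism (lead_op n).
Proof.
move=> u v; apply/funext => k; rewrite !fctE /lead_op -sumrB.
apply: eq_bigr => p _; rewrite -mulrBr -sumrB; congr (_ * _).
by apply: eq_bigr => i _; rewrite !mulrBr.
Qed.

(** * Diagonal blocks in t and in z *)

Hypothesis wt_le : forall p, p \in L -> t_weight a p <= m%:Z.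

(** The t^i part of a coefficient reads [u] at n - i + j - m. Since i >= ord_t and j - ord_t <= m,
    this index is at most n, with equality only for i = ord_t and (j, r) in [Lambda_m]. *)
Lemma pdo_shift_lead u n : (forall i, (i < n)%N -> u i = 0) ->
  pdo_shift u n = lead_op n (u n).
Proof.
move=> u0; apply/funext => k; rewrite pdo_shiftE /lead_op -big_fset_condE.
rewrite [RHS]big_mkcond /=; rewrite !big_seq; apply: eq_bigr => p pL.
have := wt_le pL; rewrite /t_weight.
set o := ord (a p.1 p.2) => wp.
have a0 i : (i < o)%N -> a p.1 p.2 i = 0 by exact: ord_min.
case: ifP => [/eqP wpE|/eqP wpE]; last first.
  apply: big1 => i _; apply: big1 => j _.
  have [io|oi] := ltnP i o; first by rewrite a0 // mul0r.
  case: ifP => mi; last by rewrite !mulr0.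
  by rewrite u0 ?mulr0 //; move: (ltn_ord i); lia.
have pmE : (p.1 = m + o :> nat)%N.
  by move: (p.1 : nat) (o : nat) wpE => x y; lia.
have pmB : (p.1 - m = o)%N by rewrite pmE addKn.
(* For [n < o] no term reaches the order of the coefficient, matching the zero falling factorial on
   the right. *)
rewrite pmB; have [on|no] := leqP o n; last first.
  rewrite ffact_small // mul0r; apply: big1 => i _; apply: big1 => j _.
  by rewrite a0 ?mul0r //; move: (ltn_ord i); lia.
rewrite (bigD1 (Ordinal (on : o < n.+1)%N)) //= [X in _ + X]big1 ?addr0;
    last first.
  move=> i ino; have {}ino : i != o :> nat by [].
  apply: big1 => j _.
  have [io|oi] := ltnP i o; first by rewrite a0 // mul0r.
  case: ifP => mi; last by rewrite !mulr0.
  by rewrite u0 ?mulr0 //; move: (ltn_ord i); lia.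
have -> : (n - o + p.1 = n + m)%N by rewrite pmE; lia.
rewrite leq_addl addnK mulr_sumr; apply: eq_bigr => j _; rewrite /lead_t pmB.
(* The falling factorial splits as (n+m)^_m * n^_o, whose first factor cancels the denominator
   produced by the integrations. *)
rewrite pmE ffactnD addnK natrM.
have c0 : ((n + m) ^_ m)%:R != 0 :> K.
  by rewrite pnatr_eq0 -lt0n ffact_gt0 leq_addl.
by field.
Qed.

(** The z^i part reads [w] at k - i + r, and i >= alpha >= r. Only i = r reaches [w k], and it
    contributes only when alpha = r, that is, for z-weight 0. *)
Lemma lead_op_diag n w k :
    (forall p, p \in Lambda_m L a m -> 0 <= z_weight a m p) ->
    (forall i, (i < k)%N -> w i = 0) ->
  lead_op n w k = (W L a m 0 n k 0%N : K) * (w k : K).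
Proof.
move=> zge w0; rewrite /lead_op /W fct_sumE /Lambda_ml -[in RHS]big_fset_condE.
rewrite mulr_suml [RHS]big_mkcond /=.
rewrite !big_seq; apply: eq_bigr => p /zge; rewrite /z_weight.
set r := p.2; set al := alpha a m p => rp.
have ral : (r <= al)%N by move: (r) (al) rp => x y; lia.
have lt0 i : (i < al)%N -> lead_t a m p i = 0 by exact: ord_min.
have vanish i : (i <= k)%N -> i != r -> (lead_t a m p i : K) *
    (((k - i + r) ^_ r)%:R * (w (k - i + r)%N : K)) = 0.
  move=> ik ir; have [il|li] := ltnP i al; first by rewrite lt0 ?mul0r.
  by rewrite w0 ?mulr0 //; move: (r) (al) ral li ir => x y; lia.
have [rk|kr] := leqP r k; last first.
  rewrite big1 ?mulr0 => [|i _]; last first.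
    by apply: vanish; move: (ltn_ord i) kr; lia.
  by case: ifP => // _; rewrite fps1_scaleE (ffact_small kr) mulr0 !mul0r.
rewrite (bigD1 (Ordinal (rk : r < k.+1)%N)) //= big1 ?addr0 => [|i ir];
    last first.
  by apply: vanish; [exact: (ltn_ord i)|exact: ir].
rewrite subnK //; case: ifP => zE; last first.
  rewrite lt0 ?mul0r ?mulr0 //; move: (r) (al) ral zE => x y; lia.
have alr : al = r by move: (r) (al) ral zE => x y; lia.
by rewrite fps1_scaleE /lead_tz addn0 -/al alr; ring.
Qed.

(** * Bounds on l and the lower ordinate *)

Lemma Pm_coef_eq0 (l : int) n r s :
    (forall p, p \in Lambda_m L a m -> l <= z_weight a m p) ->
  s%:Z < l + r%:Z -> Pm L a m n r s = 0.
Proof.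
move=> zge sl; rewrite /Pm fct_sumE big_seq_cond big1 // => p.
move=> /andP[/zge + /eqP pr]; rewrite /z_weight pr => pz.
rewrite fps1_scaleE /lead_t [X in _ * X]ord_min ?mulr0 //.
by rewrite -/(alpha a m p); lia.
Qed.

(* At k = 0 only the terms without d_z survive in W, and for those
   l = alpha p is nonnegative. *)
Lemma W0_neq0_ge0 (l : int) n : W L a m l n 0 0%N != 0 -> 0 <= l.
Proof.
apply: contraNT; rewrite -ltNge => l0; rewrite /W fct_sumE big_seq big1 // => p.
rewrite !inE /= => /andP[_ /eqP]; rewrite /z_weight => zp.
by rewrite fps1_scaleE (@ffact_small 0) ?mulr0 ?mul0r //; lia.
Qed.

Lemma lower_ordinate_W (l : int) n k :
    (forall p, p \in Lambda_m L a m -> l <= z_weight a m p) ->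
  W L a m l n k 0%N != 0 -> is_lower_ordinate (Pm L a m n) l.
Proof.
move=> zge W0.
have lb : lbound [set (ord (Pm L a m n r))%:Z - r%:Z | r in
    [set r | Pm L a m n r != 0]] l.
  move=> _ [r /= /ord_neq0 Pr <-]; rewrite leNgt; apply: contra_neqN Pr => lr.
  by apply: Pm_coef_eq0 zge _; lia.
split=> //; have [r [s [sE Ps]]] : exists r s,
    s%:Z = l + r%:Z /\ Pm L a m n r s != 0.
  apply: contrapT => nex; case/eqP: W0; rewrite /W fct_sumE.
  (* Terms with the same power of d_z may cancel in [Pm], so [W] is grouped by that power; [q]
     represents a group and fixes the exponent l + r of z. *)
  rewrite (partition_big_imfset _ (fun p : nat * nat => p.2)) /=.
  rewrite big_seq big1 // => _ /imfsetP[/= q qL ->].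
  have qz : z_weight a m q = l by move: qL; rewrite !inE => /andP[_ /eqP].
  have sE : (alpha a m q)%:Z = l + q.2%:Z by rewrite -qz /z_weight subrK.
  transitivity ((k ^_ q.2)%:R * (Pm L a m n q.2 (alpha a m q) : K)); last first.
    have -> : Pm L a m n q.2 (alpha a m q) = 0; last by rewrite mulr0.
    by apply/eqP/negPn/negP => P0; apply: nex; exists q.2, (alpha a m q).
  rewrite /Pm fct_sumE mulr_sumr big_mkcond /Lambda_ml -big_fset_condE.
  rewrite big_mkcond [RHS]big_mkcond /= !big_seq; apply: eq_bigr => p /zge pz.
  case: (eqVneq p.2 q.2) => [pq|]; last by case: ifP.
  rewrite !fps1_scaleE; case: ifP => zp.
    rewrite /lead_tz addn0 pq (_ : alpha a m p = alpha a m q); first by ring.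
    move/eqP: zp sE; rewrite /z_weight -pq => <-.
    by move: (alpha _ _ _) (alpha _ _ _) (p.2) => x y z; lia.
  (* A term of z-weight above l vanishes to order greater than l + r, so it is absent from this
     coefficient. *)
  rewrite [lead_t a m p _]ord_min ?mulr0 // -/(alpha a m p).
  move: zp pz sE; rewrite /z_weight -pq.
  by move: (alpha _ _ _) (alpha _ _ _) (p.2) => x y z; lia.
exists r => /=; first by apply: contraNneq Ps => ->.
apply/eqP; rewrite eq_le lb ?andbT; last first.
  by exists r => //=; apply: contraNneq Ps => ->.
rewrite lerBlDr -sE lez_nat leqNgt; apply: contraNN Ps => sord.
by apply/eqP; exact: ord_min.
Qed.

(** * Bijectivity and non-resonance *)

Lemma lead_op_bij n :
    (forall p, p \in Lambda_m L a m -> 0 <= z_weight a m p) ->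
  (forall k, W L a m 0 n k 0%N != 0) -> bijective (lead_op n).
Proof.
move=> zge W0; pose d k (x : K^o) : K^o := (W L a m 0 n k 0%N : K) * x.
apply: (@triangular_bij K^o _ d (lead_op_zmod_morphism n)) => [w k|k].
  exact: lead_op_diag.
exists (fun x => (W L a m 0 n k 0%N : K)^-1 * x) => x.
  by rewrite /d mulKf.
by rewrite /d mulVKf.
Qed.

(** The blocks are scalar multiplications on a field: a surjective one has nonzero scalar and is
    thus injective, as [triangular_diag_surj] requires. *)
Lemma lead_op_surj_W n :
    (forall p, p \in Lambda_m L a m -> 0 <= z_weight a m p) ->
    (forall v, exists w, lead_op n w = v) ->
  forall k, W L a m 0 n k 0%N != 0.
Proof.
move=> zge surj k; pose d k (x : K^o) : K^o := (W L a m 0 n k 0%N : K) * x.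
have d_neq0 i : (forall y, exists x, d i x = y) -> W L a m 0 n i 0%N != 0.
  move=> /(_ 1)[x dx]; apply: contra_eq_neq dx => W0.
  by rewrite /d W0 mul0r eq_sym oner_neq0.
apply: (d_neq0); apply: (triangular_diag_surj (lead_op_zmod_morphism n)) => //.
  by move=> w i; exact: lead_op_diag.
by move=> i /d_neq0 W0; exact: mulfI.
Qed.

(** Triangularity is used twice, in t and then in z. In the direct implication, surjectivity of a
    t-block makes its scalars nonzero, hence the block injective, which lets the induction on the
    t-degree proceed. *)
Lemma pdo_shift_bijP :
    (forall p, p \in Lambda_m L a m -> 0 <= z_weight a m p) ->
  bijective pdo_shift <-> forall n k, W L a m 0 n k 0%N != 0.
Proof.
move=> zge; have FB := zmod_morphism_linear pdo_shift_linear.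
split=> [[G _ FG] n|W0].
  apply: lead_op_surj_W => //.
  apply: (triangular_diag_surj FB pdo_shift_lead) => [v|i].
    by exists (G v).
  by move=> /(lead_op_surj_W zge) /(lead_op_bij zge) /bij_inj.
by apply: (triangular_bij FB pdo_shift_lead) => n; exact: lead_op_bij.
Qed.

Lemma pdo_shift_surj_le0 (l : int) :
    (forall p, p \in Lambda_m L a m -> l <= z_weight a m p) ->
  (forall v, exists u, pdo_shift u = v) -> l <= 0.
Proof.
(* The target only has to have a nonzero constant term. *)
move=> zge /(_ (fun _ _ => 1))[u] Fu; rewrite leNgt; apply/negP => l0.
have : pdo_shift u 0%N 0%N = 0.
  rewrite pdo_shift_lead // /lead_op big_seq big1 // => p /zge.
  rewrite big_ord1 /z_weight => pz.
  rewrite [lead_t a m p _]ord_min ?mul0r ?mulr0 //.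
  by rewrite -/(alpha a m p) /=; lia.
by rewrite Fu => /eqP; rewrite oner_eq0.
Qed.

End LeadingPart.

(** * The three implications *)

Theorem theorem3 (R : realType) (L : {fset nat * nat})
    (a : nat -> nat -> fps2 R[i]) (m : nat) (l : int)
    (ha : forall j r, (j, r) \in L -> a j r != 0)
    (hm : is_maximum [set t_weight a p | p in [set` L]] m%:Z)
    (hl : is_minimum [set z_weight a m p | p in [set` Lambda_m L a m]] l) :
  let cond_i :=
    linear_automorphism (fun u => pdo L a (iter m (@dt_inv R[i]) u)) in
  let cond_ii := (forall n, is_lower_ordinate (Pm L a m n) l) /\ l = 0 in
  let cond_iii := forall n k, W L a m l n k 0%N != 0 in
  [/\ cond_i -> cond_ii -> cond_iii,
      cond_i -> cond_iii -> cond_ii &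
      cond_ii -> cond_iii -> cond_i].
Proof.
have tle p : p \in L -> t_weight a p <= m%:Z.
  by move=> pL; apply: hm.2; exists p.
have zge p : p \in Lambda_m L a m -> l <= z_weight a m p.
  by move=> pL; apply: hl.2; exists p.
move=> cond_i cond_ii cond_iii; split.
- move=> [_ Fbij] [_ l0]; move: zge; rewrite /cond_iii l0 => zge.
  by apply/(pdo_shift_bijP tle zge).
- move=> [_ [G _ FG]] W0; split=> [n|].
    exact: lower_ordinate_W (W0 n 0%N).
  apply: le_anti; rewrite (W0_neq0_ge0 (W0 0%N 0%N)) andbT.
  by apply: (pdo_shift_surj_le0 tle zge) => v; exists (G v); exact: FG.
move=> [_ l0]; move: zge; rewrite /cond_iii l0 => zge W0; split.
  exact: pdo_shift_linear.
exact/(pdo_shift_bijP tle zge).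
Qed.
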